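(* Let $m\ge 1$ and let $V_1,\dots,V_m$ be two-dimensional vector spaces over $\mathbb{F}_2$, with scalar extensions $W_k=\mathbb{F}_4\otimes_{\mathbb{F}_2}V_k$. For each $k\in\{1,2,\ldots,m\}$ let $\mathbb{F}_4u_0^{(k)}$ and $\mathbb{F}_4u_1^{(k)}$ be the only two points of the projective line $\mathbb{P}(W_k)=\mathrm{PG}(1,4)$ that are not contained in $\mathbb{P}(V_k)=\mathrm{PG}(1,2)$. Then $$\mathcal{B}_m:=\Big\{\mathbb{F}_4\,u_{i_1}^{(1)}\otimes u_{i_2}^{(2)}\otimes\cdots\otimes u_{i_m}^{(m)}\ \Big|\ (i_1,i_2,\ldots,i_m)\in\{0,1\}^m\Big\}$$ is a basis of $\mathbb{P}\big(\bigotimes_{k=1}^m W_k\big)=\mathrm{PG}(2^m-1,4)$ which is invariant, as a set, under the stabiliser $G_{\mathcal{S}_{(m)}(2)}$ of the Segre variety $\mathcal{S}_{(m)}(2)$.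
   Context: For a vector space $V$, $\mathbb{P}(V)$ denotes the projective space of one-dimensional subspaces of $V$. A basis of $\mathbb{P}(V)$ is a set of points spanned by the vectors of a vector space basis of $V$. The Segre variety is $\mathcal{S}_{(m)}(2)=\{\mathbb{F}_2(a_1\otimes\cdots\otimes a_m)\mid a_k\in V_k\setminus\{0\}\}\subset\mathbb{P}\big(\bigotimes_{k=1}^m V_k\big)=\mathrm{PG}(2^m-1,2)$. Its stabiliser $G_{\mathcal{S}_{(m)}(2)}$ is the group of all elements of $\mathrm{PGL}\big(\bigotimes_{k=1}^m V_k\big)$ mapping $\mathcal{S}_{(m)}(2)$ onto itself. Each $V_k$ is regarded as a subset of $W_k$ via $a\mapsto 1\otimes a$, and $\mathbb{F}_4\otimes_{\mathbb{F}_2}\bigotimes_k V_k$ is identified with $\bigotimes_k W_k$; thus $\mathbb{P}(V_k)\subset\mathbb{P}(W_k)$, $\mathbb{P}(\bigotimes_k V_k)\subset\mathbb{P}(\bigotimes_k W_k)$. Linear maps over $\mathbb{F}_2$ are extended $\mathbb{F}_4$-linearly, so $G_{\mathcal{S}_{(m)}(2)}$ acts on $\mathbb{P}\big(\bigotimes_k W_k\big)$. *)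

(* Defs.v *)
From HB Require Import structures.
From mathcomp Require Import all_boot all_order all_algebra.
From mathcomp Require Import boolp classical_sets.

Set Implicit Arguments.
Unset Strict Implicit.
Unset Printing Implicit Defensive.

Import GRing.Theory.

Local Open Scope classical_set_scope.
Local Open Scope ring_scope.

Definition multilinear (F : fieldType) (m : nat) (V : 'I_m -> vectType F)
    (U : lmodType F) (f : (forall k, V k) -> U) : Prop :=
  forall (v : forall k, V k) (k : 'I_m) (c : F) (x y : V k),
    f (dfwith v (c *: x + y)) = c *: f (dfwith v x) + f (dfwith v y).

(* T together with tau (a_1, ..., a_m) = a_1 (x) ... (x) a_m is a tensor      *)
(* product of the V k, by the universal property; every model is allowed.     *)
Definition is_tensor_product (F : fieldType) (m : nat)
    (V : 'I_m -> vectType F) (T : vectType F)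
    (tau : (forall k, V k) -> T) : Prop :=
  multilinear tau /\
  forall (U : lmodType F) (f : (forall k, V k) -> U), multilinear f ->
    exists g : {linear T -> U},
      (forall v, g (tau v) = f v) /\
      forall h : {linear T -> U}, (forall v, h (tau v) = f v) -> h =1 g.

(* W together with iota a = 1 (x) a is the scalar extension of V along        *)
(* nu : K -> L, by the universal property; c (x) a is c *: iota a. The        *)
(* scaling operator nu \; *:%R makes iota K-linear when K acts through nu.    *)
Definition is_scalar_extension (K L : fieldType) (nu : {rmorphism K -> L})
    (V : vectType K) (W : vectType L)
    (iota : {linear V -> W | nu \; *:%R}) : Prop :=
  forall (U : lmodType L) (f : {linear V -> U | nu \; *:%R}),
    exists g : {linear W -> U},
      (forall a, g (iota a) = f a) /\
      forall h : {linear W -> U}, (forall a, h (iota a) = f a) -> h =1 g.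

Definition points (F : fieldType) (V : vectType F) : set {vspace V} :=
  [set P | \dim P = 1%N].
Arguments points {F} V.

(* P(V) as a subset of P(W), where V is viewed in W through iota.             *)
Definition subpoints (K L : fieldType) (nu : {rmorphism K -> L})
    (V : vectType K) (W : vectType L)
    (iota : {linear V -> W | nu \; *:%R}) : set {vspace W} :=
  [set <[iota a]>%VS | a in [set a : V | a != 0]].

Definition is_projective_basis (F : fieldType) (V : vectType F)
    (B : set {vspace V}) : Prop :=
  exists2 X : seq V, basis_of fullv X & B = [set <[x]>%VS | x in [set` X]].

Definition segre (F : fieldType) (m : nat) (V : 'I_m -> vectType F)
    (T : vectType F) (tau : (forall k, V k) -> T) : set {vspace T} :=
  [set <[tau a]>%VS | a in [set a : forall k, V k | forall k, a k != 0]].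

Definition preserves (F : fieldType) (V : vectType F) (g : 'End(V))
    (S : set {vspace V}) : Prop :=
  [set (g @: P)%VS | P in S] = S.

(* Elements of PGL(T) are given by the bijective linear maps representing     *)
(* them; over 'F_2 there are no scalars but 1, so PGL(T) = GL(T).             *)
Definition segre_stabiliser (F : fieldType) (m : nat) (V : 'I_m -> vectType F)
    (T : vectType F) (tau : (forall k, V k) -> T) : set 'End(T) :=
  [set g | lker g = 0%VS /\ preserves g (segre tau)].

Definition extends_scalars (K L : fieldType) (nu : {rmorphism K -> L})
    (V : vectType K) (W : vectType L) (iota : {linear V -> W | nu \; *:%R})
    (g : 'End(V)) (gW : 'End(W)) : Prop :=
  forall a, gW (iota a) = iota (g a).

Definition tensor_points (F : fieldType) (m : nat) (W : 'I_m -> vectType F)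
    (T : vectType F) (tau : (forall k, W k) -> T)
    (u : forall k, 'I_2 -> W k) : set {vspace T} :=
  [set <[tau (fun k => u k (i k))]>%VS | i in [set: 'I_m -> 'I_2]].

(* Main.v *)
Require Import Defs.
From HB Require Import structures.
From mathcomp Require Import all_boot all_order all_algebra.
From mathcomp Require Import finfield.
From mathcomp Require Import boolp classical_sets.
From mathcomp Require Import ring.

Set Implicit Arguments.
Unset Strict Implicit.
Unset Printing Implicit Defensive.

Import GRing.Theory.

Local Open Scope classical_set_scope.
Local Open Scope ring_scope.

(** Over F_2 a nonzero pure tensor of the V_k has exactly one representation
a_1 (x) ... (x) a_m with every a_k nonzero, and each V_k has exactly three
nonzero vectors e_0, e_1, e_2, any two of which add up to the third.  The
points of the Segre variety are therefore indexed by the words x in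
{0,1,2}^m; write p_x for the tensor with index x.

The key is a description of B_m by functions on the set of words.  A vector
of W_k outside the three points of V_k is a combination
c_0 e_0 + c_1 e_1 + c_2 e_2 in which c_0, c_1, c_2 are the three nonzero
elements of F_4 in some order: a 3-colouring of the line, which determines
the point and which up to a scalar the point determines
(conjugate_points).  Expanding a tensor product of such vectors gives
sum_x f(x) p_x, where f is a product of colourings of the coordinates, so that
f takes nonzero values and is injective on each line of {0,1,2}^m, a line being
three words that agree in all coordinates but one.  Such an f is a Latin
hypercube of order 3, and the converse also holds: every Latin hypercube of
order 3 is a scalar times a product of colourings
(proper_classification).  Thus B_m is the set of all points spanned by
sum_x f(x) p_x with f a Latin hypercube.

An element g of the stabiliser permutes the p_x, say g(p_x) = p_phi(x).  Two
words are adjacent, that is, lie on a common line, if and only if they differ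
and p_x + p_y is again a pure tensor (pure_sum_adjacent and adjacent_pure_sum).
Linear maps respect this condition, hence phi and its inverse preserve
adjacency (stabiliser_permutes), and so they carry Latin hypercubes to Latin
hypercubes.  Consequently g maps B_m onto itself.

That the tensors u_i form a basis is the usual statement for a tensor product
of bases: the functionals that the universal property assigns to products of
dual bases show independence, and its uniqueness clause shows that pure
tensors span (tensor_basis). *)

(** * Latin hypercubes of order 3 over F_4 *)

Lemma F4_cube (F : finFieldType) (x : F) : #|F| = 4%N -> x != 0 -> x ^+ 3 = 1.
Proof.
by move=> F4 x0; apply: (mulIf x0); rewrite -exprSr mul1r -F4 expf_card.
Qed.

Lemma F4_oppr (F : finFieldType) (x : F) : #|F| = 4%N -> - x = x.
Proof.
move=> F4; have : (-1) ^+ 3 = 1 :> F by apply: F4_cube; rewrite ?oppr_eq0 ?oner_neq0.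
by rewrite -signr_odd expr1 => N1; rewrite -mulN1r N1 mul1r.
Qed.

(** The nonzero elements are cube roots of unity, so the left-hand side divides
[x ^+ 3 - y ^+ 3 = 0] with quotient [x - y]. *)
Lemma F4_quad (F : finFieldType) (x y : F) : #|F| = 4%N ->
  x != 0 -> y != 0 -> x != y -> x ^+ 2 + x * y + y ^+ 2 = 0.
Proof.
move=> F4 x0 y0; rewrite -subr_eq0 => xy; apply: (mulfI xy).
transitivity (x ^+ 3 - y ^+ 3); first by ring.
by rewrite !F4_cube // subrr mulr0.
Qed.

(** Subtracting the instances of [F4_quad] for [p, q] and [p, r] leaves
[(q - r) * (p + q + r) = 0]. *)
Lemma F4_addE (F : finFieldType) (p q r : F) : #|F| = 4%N ->
    p != 0 -> q != 0 -> r != 0 -> p != q -> p != r -> q != r -> p + q = r.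
Proof.
move=> F4 p0 q0 r0 pq pr qr.
have : (q - r) * (p + q + r) = 0.
  transitivity ((p ^+ 2 + p * q + q ^+ 2) - (p ^+ 2 + p * r + r ^+ 2)); first by ring.
  by rewrite !F4_quad // subrr.
move/eqP; rewrite mulf_eq0 subr_eq0 (negPf qr) /= addr_eq0 => /eqP ->.
exact: F4_oppr.
Qed.

Lemma ord2_cases (i : 'I_2) : i = 0 \/ i = 1.
Proof. by case: i => [[|[|//]] p]; [left|right]; apply: val_inj. Qed.

Lemma ord3_cases (i : 'I_3) : [\/ i = 0, i = 1 | i = 2%:R].
Proof.
by case: i => [[|[|[|//]]] p]; [apply: Or31|apply: Or32|apply: Or33]; apply: val_inj.
Qed.

Lemma third (i j : 'I_3) : exists l, l != i /\ l != j.
Proof.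
by move: i j => [[|[|[|//]]] ?] [[|[|[|//]]] ?];
  first [by exists 0 | by exists 1 | by exists 2%:R].
Qed.

Definition colouring (F : fieldType) (c : 'I_3 -> F) : Prop :=
  (forall j, c j != 0) /\ injective c.

Lemma colouring_add (F : finFieldType) (c : 'I_3 -> F) i j l : #|F| = 4%N ->
  colouring c -> i != j -> i != l -> j != l -> c i + c j = c l.
Proof. by move=> F4 [c0 cI] *; apply: F4_addE; rewrite ?inj_eq. Qed.

Definition upd (m n : nat) (x : {ffun 'I_m -> 'I_n}) (k : 'I_m) (j : 'I_n) :
  {ffun 'I_m -> 'I_n} := [ffun i => if i == k then j else x i].

(** Adjacency in the Hamming graph. *)
Definition adjacent (m n : nat) (x y : {ffun 'I_m -> 'I_n}) : Prop :=
  exists k, x k != y k /\ forall l, l != k -> x l = y l.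

Lemma upd_id (m n : nat) (x : {ffun 'I_m -> 'I_n}) k : upd x k (x k) = x.
Proof. by apply/ffunP => i; rewrite ffunE; case: eqP => // ->. Qed.

Lemma updC (m n : nat) (x : {ffun 'I_m -> 'I_n}) k l a b :
  k != l -> upd (upd x k a) l b = upd (upd x l b) k a.
Proof.
move=> kl; apply/ffunP => i; rewrite !ffunE.
by case: (eqVneq i l) => // ->; rewrite eq_sym (negPf kl).
Qed.

Lemma adjacent_upd (m n : nat) (x : {ffun 'I_m -> 'I_n}) k a b :
  a != b -> adjacent (upd x k a) (upd x k b).
Proof.
move=> ab; exists k; split; first by rewrite !ffunE eqxx.
by move=> l lk; rewrite !ffunE (negPf lk).
Qed.

(** Latin hypercubes, when the field has just three nonzero elements. *)
Definition proper (F : fieldType) (m : nat) (f : {ffun 'I_m -> 'I_3} -> F) : Prop :=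
  (forall x, f x != 0) /\ (forall x y, adjacent x y -> f x != f y).

Lemma proper_line (F : fieldType) (m : nat) (f : {ffun 'I_m -> 'I_3} -> F) x k :
  proper f -> colouring (fun j => f (upd x k j)).
Proof.
case=> f0 fA; split=> // i j; apply: contra_eq => ij.
exact/fA/adjacent_upd.
Qed.

Lemma proper_comp (F : fieldType) (m : nat) (f : {ffun 'I_m -> 'I_3} -> F)
    (phi : {ffun 'I_m -> 'I_3} -> {ffun 'I_m -> 'I_3}) :
  proper f -> (forall x y, adjacent x y -> adjacent (phi x) (phi y)) ->
  proper (f \o phi).
Proof. by case=> f0 fA phiA; split=> [x|x y /phiA /fA //]; apply: f0. Qed.

Definition product_colouring (F : fieldType) (m : nat) (h : 'I_m -> 'I_3 -> F)
  (x : {ffun 'I_m -> 'I_3}) : F := \prod_k h k (x k).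

Lemma product_colouring_upd (F : fieldType) (m : nat) (h : 'I_m -> 'I_3 -> F) x k :
  product_colouring h x = h k (x k) * \prod_(l | l != k) h l (x l).
Proof. by rewrite /product_colouring (bigD1 k). Qed.

Lemma proper_product (F : fieldType) (m : nat) (h : 'I_m -> 'I_3 -> F) :
  (forall k, colouring (h k)) -> proper (product_colouring h).
Proof.
move=> hc; have h0 k j : h k j != 0 by case: (hc k).
split=> [x|x y [k [xy E]]]; first by apply/prodf_neq0 => k _.
rewrite !(@product_colouring_upd _ _ _ _ k).
under [X in h k (y k) * X]eq_bigr => l lk do rewrite -E //.
rewrite (inj_eq (mulIf _)); last by apply/prodf_neq0 => l _.
by case: (hc k) => _ hI; rewrite inj_eq.
Qed.

(** The mixed second difference along two coordinates is trivial. *)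
Definition multiplicative_squares (F : fieldType) (m : nat)
    (f : {ffun 'I_m -> 'I_3} -> F) : Prop :=
  forall x k l a b, k != l ->
    f x * f (upd (upd x k a) l b) = f (upd x k a) * f (upd x l b).

(** A property of Latin squares of order 3.  Let p, q, r, s be the entries of a
2 x 2 subsquare, with p, s and q, r the diagonals.  If q and r differ, then
p = s is the third symbol; if q = r, then p = s would force the same entry twice
in the remaining column, so that p, q, s are the three symbols.  In both cases
p s = q r. *)
Lemma proper_squares (F : finFieldType) (m : nat) (f : {ffun 'I_m -> 'I_3} -> F) :
  #|F| = 4%N -> proper f -> multiplicative_squares f.
Proof.
move=> F4 fP x k l a b kl; have [f0 fA] := fP.
have [->|ax] := eqVneq a (x k); first by rewrite upd_id.
have [->|bx] := eqVneq b (x l).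
  by rewrite updC // !upd_id mulrC.
have xl a' : upd (upd x k a') l (x l) = upd x k a'.
  by rewrite updC // upd_id.
have [c [cx cb]] := third (x l) b.
have col a' : f (upd x k a') + f (upd (upd x k a') l b) = f (upd (upd x k a') l c).
  rewrite -{1}[upd x k a']xl.
  by apply: (colouring_add F4 (proper_line (upd x k a') l fP)); rewrite eq_sym.
have colN b' : f (upd x l b') != f (upd (upd x k a) l b').
  rewrite updC // -{1}(upd_id (upd x l b') k) ffunE (negPf kl).
  by apply/fA/adjacent_upd; rewrite eq_sym.
have rowN a' : f (upd x k a') != f (upd (upd x k a') l b).
  by rewrite -{1}[upd x k a']xl; apply/fA/adjacent_upd; rewrite eq_sym.
have := col (x k); have := rowN (x k); have := colN (x l); have := colN c; have := colN b.
have := col a; have := rowN a.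
rewrite !xl !upd_id.
move: (f0 x) (f0 (upd x k a)) (f0 (upd x l b)) (f0 (upd (upd x k a) l b)).
set p := f x; set q := f (upd x k a); set r := f (upd x l b).
set s := f (upd (upd x k a) l b) => p0 q0 r0 s0 qs <- rs N pq pr Nc.
move: p q r s p0 q0 r0 s0 qs rs N pq pr Nc => p q r s p0 q0 r0 s0 qs rs N pq pr Nc.
(* [N]: the entries [p + r] and [q + s] of the remaining column differ *)
rewrite -Nc in N.
have [E|qr] := eqVneq q r.
  have ps : p != s by apply: contraNneq N => ->; rewrite addrC E.
  rewrite -E -(F4_addE F4 p0 s0 q0) // 1?eq_sym //; apply/eqP.
  rewrite -subr_eq0 -oppr_eq0; apply/eqP; rewrite -(F4_quad F4 p0 s0 ps); ring.
have -> : p = q + r by rewrite (F4_addE F4 q0 r0 p0 qr) // eq_sym.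
have -> : s = q + r by rewrite (F4_addE F4 q0 r0 s0 qr).
apply/eqP; rewrite -subr_eq0; apply/eqP; rewrite -(F4_quad F4 q0 r0 qr); ring.
Qed.

(** Induction on the number of coordinates in which [x] differs from [o]: if
there are two of them, then the square that resets each of the two to its value
in [o] expresses [f x] through words closer to [o]. *)
Lemma same_on_axes (F : fieldType) (m : nat) (f g : {ffun 'I_m -> 'I_3} -> F) o c :
    (forall x, f x != 0) -> (forall x, g x != 0) ->
    multiplicative_squares f -> multiplicative_squares g ->
    (forall k j, f (upd o k j) = c * g (upd o k j)) -> f o = c * g o ->
  forall x, f x = c * g x.
Proof.
move=> f0 g0 fS gS ax E0 x.
have [n] := ubnP #|[pred k | x k != o k]|; elim: n x => // n IH x.
rewrite ltnS => xn.
have [[k xk]|k] := pselect (exists k, x k != o k); last first.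
  suff -> : x = o by [].
  apply/ffunP => i; apply/eqP/negP => xi; case: k; exists i; exact/negP.
have card_upd (y : {ffun 'I_m -> 'I_3}) i :
    x i != o i -> (forall i', y i' != o i' -> x i' != o i') ->
    (#|[pred i' | upd y i (o i) i' != o i']| < n)%N.
  move=> xi yx; apply: leq_trans xn; apply: fintype.proper_card.
  apply/fintype.properP; split.
    apply/fintype.subsetP => i'; rewrite !inE ffunE.
    case: (eqVneq i' i) => [->|_]; last exact: yx.
    by rewrite eqxx.
  by exists i; rewrite !inE // ffunE !eqxx.
have [[l [lk xl]]|N] := pselect (exists l, l != k /\ x l != o l); last first.
  suff -> : x = upd o k (x k) by [].
  apply/ffunP => i; rewrite ffunE; case: eqVneq => [->//|ik].
  by apply/eqP/negP => xi; case: N; exists i; split=> //; apply/negP.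
have kl : k != l by rewrite eq_sym.
have := gS x k l (o k) (o l) kl; have := fS x k l (o k) (o l) kl.
rewrite (IH (upd x k (o k))) ?(IH (upd x l (o l))); try exact: card_upd.
rewrite (IH (upd (upd x k (o k)) l (o l))); last first.
  apply: card_upd => // i'; rewrite ffunE.
  by case: (eqVneq i' k) => [->|//]; rewrite eqxx.
have c0 : c != 0 by apply: contraNneq (f0 o) => c0; rewrite E0 c0 mul0r.
move: (g0 (upd (upd x k (o k)) l (o l))); set y := g _; set y1 := g _; set y2 := g _.
move=> y0 H G; apply: (mulIf (mulf_neq0 c0 y0)); rewrite H.
transitivity (c * c * (y1 * y2)); first by rewrite mulrACA.
by rewrite -G mulrACA [c * g x * _]mulrC !mulrA.
Qed.

(** On each axis through a base word, [f] is a colouring of a line and therefore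
proportional to one of the [h k i]; the product of these colourings then agrees
with [f] on all axes up to the scalar fixed by the base word, and hence
everywhere. *)
Lemma proper_classification (F : finFieldType) (m : nat) (I : Type)
    (h : 'I_m -> I -> 'I_3 -> F) (f : {ffun 'I_m -> 'I_3} -> F) : #|F| = 4%N ->
    (forall k i, colouring (h k i)) ->
    (forall k c, colouring c -> exists i a, forall j, c j = a * h k i j) ->
    proper f ->
  exists i a, a != 0 /\ forall x, f x = a * product_colouring (fun k => h k (i k)) x.
Proof.
move=> F4 hc hcl fP; pose o : {ffun 'I_m -> 'I_3} := [ffun=> 0].
have /choice [i iP] k : exists i, exists a, forall j, f (upd o k j) = a * h k i j.
  exact/hcl/proper_line.
pose g := product_colouring (fun k => h k (i k)).
have gP : proper g by apply: proper_product.
have [[f0 _] [g0 _]] := (fP, gP).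
exists i, (f o / g o); split; first by rewrite mulf_neq0 ?invr_neq0.
have Eo : f o = f o / g o * g o by rewrite divfK.
apply: (@same_on_axes _ _ f g o) => //; try exact: proper_squares.
move=> k j; have [a aP] := iP k.
pose b := \prod_(l | l != k) h l (i l) (o l).
have gE j' : g (upd o k j') = h k (i k) j' * b.
  rewrite /g (@product_colouring_upd _ _ _ _ k) ffunE eqxx; congr (_ * _).
  by apply: eq_bigr => l lk; rewrite ffunE (negPf lk).
have := aP (o k); have := gE (o k); rewrite upd_id => go fo.
rewrite aP gE fo go.
have : g o != 0 by [].
rewrite go mulf_eq0 negb_or => /andP[h0 b0].
by field; rewrite h0 b0.
Qed.

(** * Multilinear maps and tensor products of bases *)

Lemma dependent_choice (I : Type) (T : I -> Type) (P : forall i, T i -> Prop) :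
  (forall i, exists x, P i x) -> exists f, forall i, P i (f i).
Proof. by move=> PT; exists (fun i => projT1 (cid (PT i))) => i; apply: projT2. Qed.

Lemma ffun_neq (I : finType) (J : eqType) (x y : {ffun I -> J}) :
  x != y -> exists k, x k != y k.
Proof.
move=> xy; apply: contrapT => N; case/eqP: xy; apply/ffunP => k.
by apply/eqP/negP => xk; case: N; exists k; apply/negP.
Qed.

Lemma multilinear_linear (F : fieldType) (m : nat) (V : 'I_m -> vectType F)
    (U : lmodType F) (f : (forall k, V k) -> U) (v : forall k, V k) (k : 'I_m) :
  multilinear f -> exists L : {linear V k -> U}, forall x, f (dfwith v x) = L x.
Proof.
move=> fL.
have lin : linear (fun x : V k => f (dfwith v x)) by move=> c x y; apply: fL.
pose LL := GRing.isLinear.Build F (V k) U *:%R (fun x : V k => f (dfwith v x)) lin.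
pose L : {linear V k -> U} := HB.pack (fun x : V k => f (dfwith v x)) LL.
by exists L.
Qed.

Lemma dfwith_id (m : nat) (V : 'I_m -> Type) (v : forall k, V k) k :
  dfwith v (v k) = v.
Proof. by apply: functional_extensionality_dep => i; case: dfwithP. Qed.

(** The coordinates are expanded one at a time: [s] lists those in which the
argument may still be an arbitrary vector. *)
Lemma multilinear_ext (F : fieldType) (m n : nat) (V : 'I_m -> vectType F)
    (U : lmodType F) (f g : (forall k, V k) -> U) (b : forall k, 'I_n -> V k) :
    multilinear f -> multilinear g ->
    (forall k (v : V k), exists c : 'I_n -> F, v = \sum_j c j *: b k j) ->
    (forall x : {ffun 'I_m -> 'I_n}, f (fun k => b k (x k)) = g (fun k => b k (x k))) ->
  forall v, f v = g v.
Proof.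
move=> fL gL bV fg v.
suff H (s : seq 'I_m) (w : forall k, V k) :
    (forall k, k \notin s -> exists j, w k = b k j) -> f w = g w.
  by apply: (H (enum 'I_m)) => k; rewrite mem_enum.
elim: s w => [|k s IH] w wb.
  have /choice [x xP] k : exists j, w k = b k j by apply: wb.
  have -> : w = fun k => b k ([ffun k => x k] k).
    by apply: functional_extensionality_dep => k; rewrite ffunE.
  exact: fg.
have [c cE] := bV k (w k).
have [Lf LfE] := multilinear_linear w k fL; have [Lg LgE] := multilinear_linear w k gL.
rewrite -(dfwith_id w k) LfE LgE cE !linear_sum; apply: eq_bigr => j _.
rewrite !linearZ -LfE -LgE; congr (_ *: _); apply: IH => l ls.
have [<-|kl] := eqVneq k l; first by exists j; rewrite dfwith_in.
by rewrite dfwith_out //; apply: wb; rewrite inE eq_sym negb_or kl.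
Qed.

Lemma multilinear_prod (F : fieldType) (m : nat) (V : 'I_m -> vectType F)
    (L : forall k, V k -> F^o) : (forall k, linear (L k)) ->
  multilinear (fun v => \prod_k L k (v k) : F^o).
Proof.
move=> LL v k c x y; have E z : \prod_l L l (dfwith v z l) =
    L k z * \prod_(l | l != k) L l (v l).
  rewrite (bigD1 k) //= dfwith_in; congr (_ * _).
  by apply: eq_bigr => l lk; rewrite dfwith_out // eq_sym.
by rewrite !E LL mulrDl -scalerAl.
Qed.

(** Both sides are multilinear in the rows of coefficients [c k], so it suffices
to compare them when each of these is a standard basis row.  The [b k j] may
be linearly dependent, as the three nonzero vectors of a plane over F_2 are. *)
Lemma multilinear_expand (F : fieldType) (m n : nat) (V : 'I_m -> vectType F)
    (U : lmodType F) (f : (forall k, V k) -> U) (b : forall k, 'I_n -> V k)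
    (c : 'I_m -> 'I_n -> F) : multilinear f ->
  f (fun k => \sum_j c k j *: b k j) =
  \sum_(x : {ffun 'I_m -> 'I_n}) (\prod_k c k (x k)) *: f (fun k => b k (x k)).
Proof.
move=> fL.
(* the space of coefficient rows for coordinate [k] *)
pose R (k : 'I_m) : vectType F := 'rV[F]_n.
pose lc k (r : R k) := \sum_j r 0 j *: b k j.
have lcP k : linear (@lc k).
  move=> a r s; rewrite /lc scaler_sumr -big_split; apply: eq_bigr => j _ /=.
  by rewrite !mxE scalerDl scalerA.
pose L1 (r : forall k, R k) := f (fun k => lc k (r k)).
pose L2 (r : forall k, R k) := \sum_(x : {ffun 'I_m -> 'I_n})
  (\prod_k (r k 0 (x k))) *: f (fun k => b k (x k)).
have L1E (r : forall k, R k) k (s : R k) : (fun l => lc l (dfwith r s l)) =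
    dfwith (fun l => lc l (r l)) (lc k s).
  apply: functional_extensionality_dep => l; have [<-|kl] := eqVneq k l.
    by rewrite !dfwith_in.
  by rewrite !dfwith_out.
have L1L : multilinear L1 by move=> r k a s t; rewrite /L1 !L1E lcP fL.
have L2L : multilinear L2.
  move=> r k a s t; rewrite /L2 scaler_sumr -big_split; apply: eq_bigr => x _ /=.
  have Ll l : linear (fun r : R l => r 0 (x l) : F^o) by move=> a' s' t'; rewrite !mxE.
  by have /= -> := multilinear_prod Ll r a s t; rewrite scalerDl scalerA.
pose d k (j : 'I_n) : R k := delta_mx 0 j.
transitivity (L1 (fun k => \row_j c k j)).
  congr f; apply: functional_extensionality_dep => k.
  by apply: eq_bigr => j _; rewrite mxE.
rewrite (@multilinear_ext F m n R U L1 L2 d) //.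
- by apply: eq_bigr => x _; congr (_ *: _); apply: eq_bigr => k _; rewrite mxE.
- by move=> k r; exists (r 0); rewrite {1}[r]row_sum_delta.
move=> y; rewrite /L1 /L2 (bigD1 y) //= [X in _ + X]big1 ?addr0 => [|x xy].
  rewrite big1 ?scale1r => [|k _]; last by rewrite mxE !eqxx.
  congr f; apply: functional_extensionality_dep => k.
  rewrite /lc (bigD1 (y k)) //= mxE !eqxx scale1r big1 ?addr0 // => j jy.
  by rewrite mxE (negPf jy) scale0r.
have [k xk] := ffun_neq xy.
by rewrite (bigD1 k) //= mxE (negPf xk) mul0r scale0r.
Qed.

Lemma tensor_functional (F : fieldType) (m : nat) (V : 'I_m -> vectType F)
    (T : vectType F) (tau : (forall k, V k) -> T)
    (L : forall k, {linear V k -> F^o}) : is_tensor_product tau ->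
  exists M : {linear T -> F^o}, forall v, M (tau v) = \prod_k L k (v k).
Proof.
case=> _ /(_ _ _ (multilinear_prod (fun k => linearP (L k)))) [M [ME _]].
by exists M.
Qed.

(** The uniqueness clause of a universal property says that an endomorphism which
fixes the generators is the identity; applied to a projection onto [S], this
shows that the generators span. *)
Lemma rigid_full (F : fieldType) (T : vectType F) (A : set T) (S : {vspace T}) :
    (forall h : {linear T -> T}, (forall a, A a -> h a = a) -> h =1 id) ->
  (forall a, A a -> a \in S) -> S = fullv.
Proof.
move=> rigA AS; apply/vspaceP => v; rewrite memvf.
by rewrite -[v](rigA (projv S)) ?memv_proj // => a /AS /projv_id.
Qed.

Lemma tensor_full (F : fieldType) (m : nat) (V : 'I_m -> vectType F)
    (T : vectType F) (tau : (forall k, V k) -> T) (S : {vspace T}) :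
  is_tensor_product tau -> (forall v, tau v \in S) -> S = fullv.
Proof.
case=> tauL /(_ T tau tauL) [g [_ gU]] tauS.
apply: (@rigid_full _ _ (range tau)) => [h hid x|_ [v _ <-] //].
have hE v : h (tau v) = tau v by apply: hid; exists v.
by rewrite (gU h) // -(gU idfun).
Qed.

Lemma scalar_extension_full (K L : fieldType) (nu : {rmorphism K -> L})
    (V : vectType K) (W : vectType L) (iota : {linear V -> W | nu \; *:%R})
    (S : {vspace W}) :
  is_scalar_extension iota -> (forall a, iota a \in S) -> S = fullv.
Proof.
move=> /(_ W iota) [g [_ gU]] iotaS.
apply: (@rigid_full _ _ (range iota)) => [h hid x|_ [v _ <-] //].
have hE v : h (iota v) = iota v by apply: hid; exists v.
by rewrite (gU h) // -(gU idfun).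
Qed.

Lemma dual_basis (F : fieldType) (T : vectType F) (I : finType) (t : I -> T)
    (M : I -> {linear T -> F^o}) :
    (forall i j, M i (t j) = (j == i)%:R) -> <<codom t>>%VS = fullv ->
  basis_of fullv (codom t).
Proof.
move=> Mt tF; rewrite basisEdim tF subvv /=.
suff: free (codom_tuple t) by rewrite /free tF size_tuple => /eqP ->.
apply/freeP => c c0 i; move/(congr1 (M (enum_val i))): c0.
rewrite linear_sum linear0 (bigD1 i) //= big1 ?addr0 => [|j ji].
  by rewrite linearZ /= nth_codom Mt eqxx => /eqP; rewrite mulf_eq0 oner_eq0 orbF => /eqP.
by rewrite linearZ /= nth_codom Mt (inj_eq enum_val_inj) (negPf ji) [LHS]mulr0.
Qed.

Lemma tensor_basis (F : fieldType) (m n : nat) (V : 'I_m -> vectType F)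
    (T : vectType F) (tau : (forall k, V k) -> T) (b : forall k, 'I_n -> V k)
    (M : forall k, 'I_n -> {linear V k -> F^o}) : is_tensor_product tau ->
    (forall k (v : V k), exists c : 'I_n -> F, v = \sum_j c j *: b k j) ->
    (forall k i j, M k i (b k j) = (j == i)%:R) ->
  basis_of fullv (codom (fun x : {ffun 'I_m -> 'I_n} => tau (fun k => b k (x k)))).
Proof.
move=> tauP bV Mb.
have /choice [N NE] x : exists N : {linear T -> F^o},
    forall v, N (tau v) = \prod_k M k (x k) (v k) by exact: tensor_functional.
apply: (@dual_basis F T {ffun 'I_m -> 'I_n} _ N) => [x y|].
  rewrite NE; have [->|xy] := eqVneq y x.
    by rewrite big1 // => k _; rewrite Mb eqxx.
  have [k xk] := ffun_neq xy.
  by rewrite (bigD1 k) //= Mb (negPf xk) mul0r.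
apply: (tensor_full tauP) => v.
have /choice [c cE] k := bV k (v k).
have -> : v = fun k => \sum_j c k j *: b k j by apply: functional_extensionality_dep.
case: tauP => tauL _; rewrite multilinear_expand // memv_suml // => x _.
by rewrite memvZ // memv_span // codom_f.
Qed.

(** * The three points of the line over F_2 and the two conjugate points *)

Lemma basis2_coord (F : fieldType) (V : vectType F) (a b : V) :
    basis_of fullv [:: a; b] ->
  exists M : 'I_2 -> {linear V -> F^o},
    [/\ forall v, v = M 0 v *: a + M 1 v *: b,
        M 0 a = 1, M 0 b = 0, M 1 a = 0 & M 1 b = 1].
Proof.
move=> abB; pose X := [tuple a; b]; have XB : basis_of fullv X by [].
exists (fun i => coord X i).
have fX := basis_free XB.
have H i j := coord_free i j fX.
split; last 4 first.
- exact: (H 0 0).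
- exact: (H 1 0).
- exact: (H 0 1).
- exact: (H 1 1).
move=> v; rewrite {1}(coord_basis XB (memvf v)) big_ord_recl big_ord1 /=.
by congr (_ + coord _ _ _ *: _); apply: val_inj.
Qed.

(** [e] lists the nonzero vectors of a plane over F_2; the three play symmetric
roles. *)
Definition nonzero_triple (V : vectType 'F_2) (e : 'I_3 -> V) : Prop :=
  [/\ forall i j l, i != j -> i != l -> j != l -> e i + e j = e l,
      forall j, e j != 0 & forall v, v != 0 -> exists j, v = e j].

(** Each nonzero functional on the plane vanishes at exactly one nonzero vector,
whence the functionals carry the same index set. *)
Lemma F2_plane (V : vectType 'F_2) : \dim {:V} = 2%N ->
  exists e : 'I_3 -> V, exists L : 'I_3 -> {linear V -> ('F_2)^o},
    nonzero_triple e /\ forall c j, L c (e j) = (j != c)%:R.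
Proof.
move=> dV; have [a [b abB]] : exists a b : V, basis_of fullv [:: a; b].
  have: exists2 s : seq V, size s = 2%N & basis_of fullv s.
    by exists (vbasis {:V}); rewrite ?size_tuple ?vbasisP.
  by case=> [[|a [|b [|]]]] // _ abB; exists a, b.
have [M [ME Maa Mab Mba Mbb]] := basis2_coord abB.
have two (x : V) : x + x = 0.
  by rewrite -mulr2n -scaler_nat (_ : 2%:R = 0) ?scale0r //; apply/eqP.
pose M2 : {linear V -> ('F_2)^o} := (M 0 \+ M 1)%R.
exists (fun j => nth 0 [:: a; b; a + b] j).
exists (fun c => nth (M 0) [:: M 1; M 0; M2] c).
have LE (c j : 'I_3) : (nth (M 0) [:: M 1; M 0; M2] c : {linear V -> ('F_2)^o})
      (nth 0 [:: a; b; a + b] j) = (j != c)%:R.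
  case: c j => [[|[|[|//]]] ?] [[|[|[|//]]] ?] /=;
    rewrite ?linearD /= ?Maa ?Mab ?Mba ?Mbb; exact/eqP.
have K1 : a + (a + b) = b by rewrite addrA two add0r.
have K2 : a + b + a = b by rewrite addrC.
have K4 : a + b + b = a by rewrite -addrA two addr0.
have K3 : b + (a + b) = a by rewrite addrC.
split=> //; split.
- case=> [[|[|[|//]]] ?] [[|[|[|//]]] ?] [[|[|[|//]]] ?] //= _ _ _;
    by rewrite ?K1 ?K2 ?K3 ?K4 // addrC.
- move=> j; have [l [lj _]] := third j j.
  by apply/eqP => ej; have := LE l j; rewrite ej linear0 eq_sym lj.
have F2 (x : 'F_2) : x = 0 \/ x = 1 by apply: ord2_cases.
move=> v; rewrite [v]ME => v0.
have [E0|E0] := F2 (M 0 v); have [E1|E1] := F2 (M 1 v); move: v0; rewrite E0 E1.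
- by rewrite !scale0r addr0 eqxx.
- by exists 1; rewrite scale0r scale1r add0r.
- by exists 0; rewrite scale0r scale1r addr0.
- by exists 2%:R; rewrite !scale1r.
Qed.

Lemma vline_scale (F : fieldType) (V : vectType F) (v w : V) (x : F) :
  v != 0 -> v = x *: w -> <[v]>%VS = <[w]>%VS.
Proof.
move=> v0 vE; apply/eqP; rewrite eqEdim -memvE; apply/andP; split.
  by apply/vlineP; exists x.
by rewrite !dim_vline v0 leq_b1.
Qed.

Lemma vlineZ (F : fieldType) (V : vectType F) (x : F) (w : V) :
  x != 0 -> <[x *: w]>%VS = <[w]>%VS.
Proof.
move=> x0; have [->|w0] := eqVneq w 0; first by rewrite scaler0.
by apply: (@vline_scale _ _ _ _ x) => //; rewrite scaler_eq0 negb_or x0.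
Qed.

(** Put a = e_0 and b = e_1, so that e_2 = a + b.  For a colouring c, the sum of
the c_j e_j is c_1 a + c_0 b, since c_0 + c_2 = c_1 and c_1 + c_2 = c_0.  A vector
x a + y b lies outside the three points a, b, a + b exactly when x and y are
nonzero and distinct, that is, when y, x, x + y is a colouring.  Each point
outside P(V) thus corresponds to a colouring up to a scalar. *)
Lemma conjugate_points (F : finFieldType) (nu : {rmorphism 'F_2 -> F})
    (V : vectType 'F_2) (W : vectType F) (iota : {linear V -> W | nu \; *:%R})
    (e : 'I_3 -> V) (u : 'I_2 -> W) : #|F| = 4%N ->
    nonzero_triple e ->
    is_scalar_extension iota -> <[u 0%R]>%VS != <[u 1%R]>%VS ->
    points W `\` subpoints iota = [set <[u 0%R]>%VS; <[u 1%R]>%VS] ->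
  [/\ exists M : 'I_2 -> {linear W -> F^o}, forall i j, M i (u j) = (j == i)%:R,
      forall w, exists c : 'I_2 -> F, w = \sum_j c j *: u j
    & exists h : 'I_2 -> 'I_3 -> F,
      [/\ forall i, colouring (h i), forall i, u i = \sum_j h i j *: iota (e j)
        & forall c, colouring c -> exists i a, forall j, c j = a * h i j]].
Proof.
move=> F4 [eD e0 eV] iotaP u01 uP.
pose a := iota (e 0); pose b := iota (e 1).
have e2 : iota (e 2%:R) = a + b by rewrite -(eD 0 1) // raddfD.
have ab_full : <<[:: a; b]>>%VS = fullv.
  apply: (scalar_extension_full iotaP) => v.
  have aS : a \in <<[:: a; b]>>%VS by rewrite memv_span // inE eqxx.
  have bS : b \in <<[:: a; b]>>%VS by rewrite memv_span // !inE eqxx orbT.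
  have [->|/eV [j ->]] := eqVneq v 0; first by rewrite raddf0 mem0v.
  by case: (ord3_cases j) => ->; rewrite // e2 memvD.
have uW i : points W <[u i]>%VS /\ ~ subpoints iota <[u i]>%VS.
  have : (points W `\` subpoints iota) <[u i]>%VS.
    by rewrite uP; case: (ord2_cases i) => ->; [left|right].
  by [].
have un0 i : u i != 0.
  case: (uW i) => d _; apply/eqP => ui0; move: d.
  by rewrite /points /= ui0 dim_vline eqxx.
have uF : free [:: u 0; u 1].
  rewrite free_cons seq1_free un0 andbT span_seq1; apply: contra u01 => u0.
  by have /vlineP[x /(vline_scale (un0 _)) ->] := u0.
have dW : \dim {:W} = 2%N.
  apply/eqP; rewrite eqn_leq -{1}ab_full dim_span /=.
  by have := dimvS (subvf <<[:: u 0%R; u 1%R]>>%VS); rewrite (eqP uF).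
have uB : basis_of fullv [:: u 0; u 1] by rewrite basisEfree uF subvf dW.
have abB : basis_of fullv [:: a; b] by rewrite basisEdim ab_full subvv dW.
have [M [ME M00 M01 M10 M11]] := basis2_coord uB.
have [N [NE N00 N01 N10 N11]] := basis2_coord abB.
have N0ab : N 0 (a + b) = 1 by rewrite linearD N00 N01 addr0.
have N1ab : N 1 (a + b) = 1 by rewrite linearD N10 N11 add0r.
have sumE (c : 'I_3 -> F) : colouring c ->
    \sum_j c j *: iota (e j) = c 1 *: a + c 0 *: b.
  move=> cP; have d01 : c 0 + c 2%:R = c 1 by apply: colouring_add.
  have d10 : c 1 + c 2%:R = c 0 by apply: colouring_add.
  rewrite 2!big_ord_recl big_ord1.
  have -> : lift ord0 (lift ord0 ord0) = 2%:R :> 'I_3 by apply: val_inj.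
  have -> : lift ord0 ord0 = 1 :> 'I_3 by apply: val_inj.
  transitivity ((c 0 + c 2%:R) *: a + (c 1 + c 2%:R) *: b); last by rewrite d01 d10.
  by rewrite e2 !scalerDl scalerDr [RHS]addrACA [LHS]addrA.
split.
- by exists M => i j; case: (ord2_cases i) (ord2_cases j) => -> [] ->.
- move=> w; exists (M ^~ w); rewrite {1}[w]ME big_ord_recl big_ord1.
  congr (_ + M _ _ *: u _); exact: val_inj.
have hE i : exists h, colouring h /\ u i = \sum_j h j *: iota (e j).
  have [_ ui] := uW i.
  pose h (j : 'I_3) := nth 0 [:: N 1 (u i); N 0 (u i); N 0 (u i) + N 1 (u i)] j.
  have lin x j : u i <> x *: iota (e j).
    by move=> E; apply: ui; exists (e j); [exact: e0|rewrite (vline_scale (un0 i) E)].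
  have N0 : N 0 (u i) != 0.
    apply/eqP => E; apply: (lin (N 1 (u i)) 1).
    by rewrite {1}[u i]NE E scale0r add0r.
  have N1 : N 1 (u i) != 0.
    apply/eqP => E; apply: (lin (N 0 (u i)) 0).
    by rewrite {1}[u i]NE E scale0r addr0.
  have N2 : N 0 (u i) != N 1 (u i).
    apply/eqP => E; apply: (lin (N 0 (u i)) 2%:R).
    by rewrite {1}[u i]NE -E -scalerDr e2.
  have hP : colouring h.
    split.
      move=> j; case: (ord3_cases j) => -> //=.
      by rewrite addr_eq0 F4_oppr.
    have N02 : N 0 (u i) + N 1 (u i) != N 0 (u i).
      by rewrite -subr_eq0 addrAC subrr add0r.
    have N12 : N 0 (u i) + N 1 (u i) != N 1 (u i).
      by rewrite -subr_eq0 addrK.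
    move=> j j'; case: (ord3_cases j) (ord3_cases j') => -> [] -> //= /eqP;
      by rewrite ?(negPf N2) ?(negPf N02) ?(negPf N12) // eq_sym
        ?(negPf N2) ?(negPf N02) ?(negPf N12).
  by exists h; split=> //; rewrite sumE.
have [h hP] := choice hE.
exists h; split; try by move=> i; case: (hP i).
move=> c cP; pose w := \sum_j c j *: iota (e j).
have wS : ~ subpoints iota <[w]>%VS.
  case=> v v0 vw; have := memv_line w; rewrite -vw => /vlineP[x].
  have [j ->] := eV v v0; rewrite /w sumE // => E.
  have [c0 cI] := cP.
  have := congr1 (N 1) E; have := congr1 (N 0) E.
  rewrite !linearD !linearZ /= N00 N01 N10 N11 !scaler0 ![_ *: 1]mulr1 addr0 add0r.
  case: (ord3_cases j) => ->.
  - by rewrite N10 scaler0 => _ /eqP; rewrite (negPf (c0 _)).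
  - by rewrite N01 scaler0 => /eqP; rewrite (negPf (c0 _)).
  - by rewrite e2 N0ab N1ab => <- /cI.
have w0 : w != 0.
  apply/eqP => E; have := congr1 (N 1) E; rewrite /w sumE // linear0.
  rewrite linearD !linearZ /= N10 N11 scaler0 add0r [_ *: 1]mulr1 => /eqP.
  by case: cP => c0 _; rewrite (negPf (c0 _)).
have [i [x wx]] : exists i x, w = x *: u i.
  have : (points W `\` subpoints iota) <[w]>%VS.
    by split=> //; rewrite /points /= dim_vline w0.
  rewrite uP; case=> wu; [exists 0|exists 1]; apply/vlineP; rewrite -wu; exact: memv_line.
exists i, x.
have [hc uE] := hP i.
have wE : w = \sum_j (x * h i j) *: iota (e j).
  by rewrite wx {1}uE scaler_sumr; apply: eq_bigr => j _; rewrite scalerA.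
have x0 : x != 0 by apply: contraNneq w0 => x0; rewrite wx x0 scale0r.
have xhc : colouring (fun j => x * h i j).
  case: hc => h0 hI; split=> [j|j j' /(mulfI x0) /hI //]; exact: mulf_neq0.
move: wE; rewrite /w !sumE // => E.
have := congr1 (N 1) E; have := congr1 (N 0) E.
rewrite !linearD !linearZ /= N00 N01 N10 N11 !scaler0 !addr0 !add0r ![_ *: 1]mulr1.
move=> E1 E0 j; case: (ord3_cases j) => -> //.
by rewrite -(@colouring_add _ c 0 1) // E0 E1; apply: (colouring_add F4 xhc).
Qed.

(** * Pure tensors over F_2 and the stabiliser of the Segre variety *)

Lemma F2_vline_inj (V : vectType 'F_2) (v w : V) :
  v != 0 -> <[v]>%VS = <[w]>%VS -> v = w.
Proof.
move=> v0 vw; have := memv_line v; rewrite vw => /vlineP[x vE].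
have [x0|x1] : x = 0 \/ x = 1 by apply: ord2_cases.
  by rewrite vE x0 scale0r eqxx in v0.
by rewrite vE x1 scale1r.
Qed.

(** Products of functionals that each vanish at a single [e k j] give the tests
that separate pure tensors: the test attached to [c] detects whether a word
avoids [c] in every coordinate. *)
Lemma avoiding_functional (F : fieldType) (m n : nat) (V : 'I_m -> vectType F)
    (T : vectType F) (tau : (forall k, V k) -> T) (e : forall k, 'I_n -> V k)
    (L : forall k, 'I_n -> {linear V k -> F^o}) : is_tensor_product tau ->
    (forall k c j, L k c (e k j) = (j != c)%:R) ->
  forall c : {ffun 'I_m -> 'I_n}, exists N : {linear T -> F^o},
    forall x : {ffun 'I_m -> 'I_n},
      N (tau (fun k => e k (x k))) = [forall k, x k != c k]%:R.
Proof.
move=> tauP Le c; have [N NE] := tensor_functional (fun k => L k (c k)) tauP.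
exists N => x; rewrite NE; case: forallP => [xc|/forallP].
  by rewrite big1 // => k _; rewrite Le xc.
rewrite negb_forall => /existsP[k /negbTE xk].
by rewrite (bigD1 k) //= Le xk mul0r.
Qed.

Definition other (j : 'I_3) : 'I_3 := j + 1.

Lemma other_neq j : other j != j.
Proof. by case: (ord3_cases j) => ->. Qed.

Section PureTensors.

Variables (m : nat) (V : 'I_m -> vectType 'F_2) (VT : vectType 'F_2).
Variables (tauV : (forall k, V k) -> VT) (e : forall k, 'I_3 -> V k).
Variable L : forall k, 'I_3 -> {linear V k -> ('F_2)^o}.
Hypothesis tauVP : is_tensor_product tauV.
Hypothesis Le : forall k c j, L k c (e k j) = (j != c)%:R.
Hypothesis eP : forall k, nonzero_triple (e k).

Definition pure (x : {ffun 'I_m -> 'I_3}) : VT := tauV (fun k => e k (x k)).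

Lemma pure_neq0 x : pure x != 0.
Proof.
have [N NE] := avoiding_functional tauVP Le [ffun k => other (x k)].
apply/eqP => E; have := NE x; rewrite -/(pure x) E linear0.
rewrite (_ : [forall k, _] = true) //; apply/forallP => k.
by rewrite ffunE eq_sym other_neq.
Qed.

Lemma pure_inj : injective pure.
Proof.
move=> x y E; apply/eqP/negP => /negP /ffun_neq [k xy].
have [N NE] := avoiding_functional tauVP Le
  [ffun i => if i == k then y k else other (x i)].
have := congr1 N E; rewrite !NE.
have -> : [forall i, x i != [ffun i => if i == k then y k else other (x i)] i].
  apply/forallP => i; rewrite ffunE; case: (eqVneq i k) => [->|_] //.
  by rewrite eq_sym other_neq.
case: forallP => // /(_ k).
by rewrite ffunE !eqxx.
Qed.

(** If x_l and z_l differed, some word c would meet y in coordinate k and z in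
coordinate l while avoiding x everywhere; its test would then give 1 + 0 = 0. *)
Lemma pure_sum_coord (x y z : {ffun 'I_m -> 'I_3}) k :
    x k != y k -> pure x + pure y = pure z ->
  forall l, l != k -> x l = z l.
Proof.
move=> xy E l lk; apply/eqP/negP => /negP xz.
pose c := [ffun i => if i == k then y k else if i == l then z l else other (x i)].
have [N NE] := avoiding_functional tauVP Le c.
have := congr1 N E; rewrite linearD !NE.
have -> : [forall i, x i != c i].
  apply/forallP => i; rewrite ffunE; case: (eqVneq i k) => [->|_] //.
  by case: (eqVneq i l) => [->|_] //; rewrite eq_sym other_neq.
have -> : [forall i, y i != c i] = false.
  by apply/negbTE; rewrite negb_forall; apply/existsP; exists k; rewrite ffunE !eqxx.
have -> : [forall i, z i != c i] = false.
  apply/negbTE; rewrite negb_forall; apply/existsP; exists l.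
  by rewrite ffunE (negPf lk) !eqxx.
by [].
Qed.

Lemma pure_sum_adjacent x y z : x != y -> pure x + pure y = pure z -> adjacent x y.
Proof.
move=> /ffun_neq [k xy] E; exists k; split=> // l lk.
rewrite (pure_sum_coord xy E lk) (@pure_sum_coord y x z k) //; first by rewrite eq_sym.
by rewrite addrC.
Qed.

Lemma adjacent_pure_sum x y : adjacent x y ->
  exists z, pure x + pure y = pure z.
Proof.
case=> k [xy E]; have [c [cx cy]] := third (x k) (y k); exists (upd x k c).
have [M ME] := multilinear_linear (fun l => e l (x l)) k tauVP.1.
have pE (z : {ffun 'I_m -> 'I_3}) :
    (forall l, l != k -> x l = z l) -> pure z = M (e k (z k)).
  move=> xz; rewrite -ME; congr tauV; apply: functional_extensionality_dep => l.
  have [<-|kl] := eqVneq k l; first by rewrite dfwith_in.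
  by rewrite dfwith_out // xz // eq_sym.
rewrite !pE //; last by move=> l lk; rewrite ffunE (negPf lk).
by case: (eP k) => eD _ _; rewrite -linearD ffunE eqxx (eD _ _ c xy) // eq_sym.
Qed.

Lemma segreE : segre tauV = [set <[pure x]>%VS | x in setT].
Proof.
apply/seteqP; split=> [_ [a a0 <-]|_ [x _ <-]].
  have /choice [x xE] k : exists j, a k = e k j by case: (eP k) => _ _; apply; apply: a0.
  exists [ffun k => x k] => //; congr <[tauV _]>%VS.
  by apply: functional_extensionality_dep => k; rewrite ffunE xE.
by exists (fun k => e k (x k)) => // k; case: (eP k) => _ e0 _.
Qed.

(** Adjacency of words means that the sum of two distinct pure tensors is again
pure, a condition that [g] and its inverse respect. *)
Lemma stabiliser_permutes (g : 'End(VT)) : segre_stabiliser tauV g ->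
  exists phi psi, [/\ cancel psi phi, forall x, g (pure x) = pure (phi x),
    forall x y, adjacent x y -> adjacent (phi x) (phi y)
    & forall x y, adjacent x y -> adjacent (psi x) (psi y)].
Proof.
rewrite /segre_stabiliser /preserves segreE => -[/eqP g0 gS].
have gI : injective g by apply/lker0P.
have neq x y : adjacent x y -> x != y.
  by case=> k [xy _]; apply: contraNneq xy => ->.
have /choice [phi phiE] x : exists y, g (pure x) = pure y.
  have : [set (g @: P)%VS | P in [set <[pure x]>%VS | x in setT]] <[g (pure x)]>%VS.
    by exists <[pure x]>%VS; [exists x|rewrite limg_line].
  rewrite gS => -[y _ yE]; exists y; apply/esym/F2_vline_inj => //.
  exact: pure_neq0.
have /choice [psi psiE] y : exists x, g (pure x) = pure y.
  have : [set <[pure x]>%VS | x in setT] <[pure y]>%VS by exists y.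
  rewrite -gS => -[_ [x _ <-]]; rewrite limg_line phiE => E; exists x.
  by rewrite phiE; apply: F2_vline_inj E; apply: pure_neq0.
have psiK : cancel psi phi by move=> y; apply: pure_inj; rewrite -phiE psiE.
have phiI : injective phi.
  by move=> x y E; apply/pure_inj/gI; rewrite !phiE E.
exists phi, psi; split=> // x y xy; have [z E] := adjacent_pure_sum xy.
  apply: (@pure_sum_adjacent _ _ (phi z)); first by rewrite inj_eq // neq.
  by rewrite -!phiE -linearD E.
apply: (@pure_sum_adjacent _ _ (psi z)).
  by rewrite (can_eq psiK) neq.
by apply: gI; rewrite linearD /= !psiE E.
Qed.

End PureTensors.

(** * Invariance of the basis *)

Theorem theorem2 (m : nat) (m_gt0 : (0 < m)%N)
    (F4 : finFieldType) (card_F4 : #|F4| = 4%N)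
    (nu : {rmorphism 'F_2 -> F4})
    (V : 'I_m -> vectType 'F_2) (dimV : forall k, \dim {:V k} = 2%N)
    (W : 'I_m -> vectType F4)
    (iota : forall k, {linear V k -> W k | nu \; *:%R})
    (iotaP : forall k, is_scalar_extension (iota k))
    (VT : vectType 'F_2) (tauV : (forall k, V k) -> VT)
    (tauVP : is_tensor_product tauV)
    (WT : vectType F4) (tauW : (forall k, W k) -> WT)
    (tauWP : is_tensor_product tauW)
    (iotaT : {linear VT -> WT | nu \; *:%R})
    (iotaTP : is_scalar_extension iotaT)
    (iotaT_tauV : forall a : (forall k, V k),
       iotaT (tauV a) = tauW (fun k => iota k (a k)))
    (u : forall k, 'I_2 -> W k)
    (u_neq : forall k, <[u k 0%R]>%VS != <[u k 1%R]>%VS)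
    (uP : forall k,
       points (W k) `\` subpoints (iota k) = [set <[u k 0%R]>%VS; <[u k 1%R]>%VS]) :
  \dim {:WT} = (2 ^ m)%N /\
  is_projective_basis (tensor_points tauW u) /\
  (forall (g : 'End(VT)) (gW : 'End(WT)),
     segre_stabiliser tauV g -> extends_scalars iotaT g gW ->
     preserves gW (tensor_points tauW u)).
Proof.
have /dependent_choice [e /dependent_choice [L eLP]] k := F2_plane (dimV k).
have eP k : nonzero_triple (e k) by case: (eLP k).
have Le k : forall c j, L k c (e k j) = (j != c)%:R by case: (eLP k).
have cP k := conjugate_points card_F4 (eP k) (@iotaP k) (u_neq k) (uP k).
have /dependent_choice [M MP] k : exists M : 'I_2 -> {linear W k -> F4^o},
    forall i j, M i (u k j) = (j == i)%:R by case: (cP k).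
have uW k : forall w, exists c : 'I_2 -> F4, w = \sum_j c j *: u k j by case: (cP k).
have /choice [h hP] k : exists h : 'I_2 -> 'I_3 -> F4,
      [/\ forall i, colouring (h i), forall i, u k i = \sum_j h i j *: iota k (e k j)
        & forall c, colouring c -> exists i a, forall j, c j = a * h i j].
  by case: (cP k).
have hc k i : colouring (h k i) by case: (hP k).
have uE k i : u k i = \sum_j h k i j *: iota k (e k j) by case: (hP k).
have hcl k : forall c, colouring c -> exists i a, forall j, c j = a * h k i j.
  by case: (hP k).
pose t (i : {ffun 'I_m -> 'I_2}) := tauW (fun k => u k (i k)).
have tB : basis_of fullv (codom t) by apply: tensor_basis tauWP uW MP.
have BE : tensor_points tauW u = [set <[x]>%VS | x in [set` codom t]].
  apply/seteqP; split=> [_ [i _ <-]|_ [_ /codomP[i ->] <-]]; last by exists i.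
  exists (t [ffun k => i k]); first exact: codom_f.
  by congr <[tauW _]>%VS; apply: functional_extensionality_dep => k; rewrite ffunE.
split; first by rewrite (size_basis tB) card_ffun !card_ord.
split; first by exists (codom t).
move=> g gW gS gE.
have [phi [psi [psiK gphi phiA psiA]]] := stabiliser_permutes tauVP Le eP gS.
(* [BC] below describes B_m as the set of points [C f] with [f] proper *)
pose C (f : {ffun 'I_m -> 'I_3} -> F4) := \sum_x f x *: iotaT (pure tauV e x).
have CE (i : 'I_m -> 'I_2) : tauW (fun k => u k (i k)) =
    C (product_colouring (fun k => h k (i k))).
  have -> : (fun k => u k (i k)) =
      fun k => \sum_j h k (i k) j *: iota k (e k j).
    by apply: functional_extensionality_dep => k; apply: uE.
  case: tauWP => tauL _; rewrite (multilinear_expand _ _ tauL).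
  by apply: eq_bigr => x _; rewrite iotaT_tauV.
have BC : tensor_points tauW u = [set <[C f]>%VS | f in @proper F4 m].
  apply/seteqP; split=> [_ [i _ <-]|_ [f fP <-]].
    exists (product_colouring (fun k => h k (i k))); last by rewrite CE.
    exact: proper_product.
  have [i [a [a0 fE]]] := proper_classification card_F4 hc hcl fP.
  exists i => //; rewrite CE -(vlineZ _ a0).
  congr <[_]>%VS; rewrite scaler_sumr; apply: eq_bigr => x _.
  by rewrite scalerA fE.
have phiK : cancel phi psi := canF_sym psiK.
have gC f : gW (C f) = C (f \o psi).
  rewrite linear_sum /C [RHS](reindex phi) /=; last by exists psi => x _.
  by apply: eq_bigr => x _; rewrite linearZ /= gE gphi phiK.
rewrite /preserves BC; apply/seteqP; split=> [_ [_ [f fP <-] <-]|_ [f fP <-]].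
  by rewrite limg_line gC; exists (f \o psi) => //; apply: proper_comp.
exists <[C (f \o phi)]>%VS; first by exists (f \o phi) => //; apply: proper_comp.
rewrite limg_line gC; congr <[C _]>%VS.
by apply: functional_extensionality_dep => x /=; rewrite psiK.
Qed.
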